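(* If $G$ belongs to the class $\mathcal{G}$, then the graphic arrangement $\mathcal{A}_G$ is flag-accurate. In particular, if $G$ is trivially perfect, then $\mathcal{A}_G$ is flag-accurate.
   Context: Let $\mathbb{K}$ be a field. For a simple graph $G$ with vertices $v_1,\dots,v_n$, the graphic arrangement in $\mathbb{K}^n$ is $\mathcal{A}_G=\{\ker(x_i-x_j):\{v_i,v_j\}\text{ an edge}\}$. $\mathcal{G}$ is the smallest class of simple graphs such that: (1) every one-vertex graph is in $\mathcal{G}$; (2) the disjoint union of two graphs in $\mathcal{G}$ is in $\mathcal{G}$; (3) any graph obtained from $G,H\in\mathcal{G}$ by identifying a vertex of $G$ with a vertex of $H$ is in $\mathcal{G}$; (4) if $G\in\mathcal{G}$, then the graph obtained by adding a new vertex adjacent to all vertices of $G$ is in $\mathcal{G}$. Trivially perfect graphs are the graphs obtainable using only rules (1), (2) and (4). For a central arrangement $\mathcal{A}$ in $V=\mathbb{K}^n$: $L(\mathcal{A})$ is the set of intersections of subsets of $\mathcal{A}$ (including $V$); $\mathcal{A}^X=\{H\cap X:H\in\mathcal{A},X\not\subseteq H\}$; $\mathcal{A}$ is free if $D(\mathcal{A})=\{\theta\in\mathrm{Der}(S):\theta(\alpha_H)\in\alpha_HS\ \forall H\}$ is free over $S=\mathbb{K}[x_1,\dots,x_n]$, exponents being degrees of a homogeneous basis. $\mathcal{A}$ is flag-accurate if it is free with exponents $e_1\le\dots\le e_n$ and there is a flag $X_1\subseteq\dots\subseteq X_n=V$ in $L(\mathcal{A})$ with $\dim X_d=d$ and $\mathcal{A}^{X_d}$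 free with exponents $(e_1,\dots,e_d)$ for all $d$.
   Formalization: In the definition of flag-accurate, flats X_d are required only for d ≥ 1 with d at least the dimension of the intersection of all hyperplanes: for disconnected G (e.g. two isolated vertices) no flats of smaller dimension exist. For connected G the definition is unchanged. *)

(* Defs.v *)
From HB Require Import structures.
From mathcomp Require Import all_boot all_order all_algebra.
From mathcomp Require Import finmap mpoly.

Set Implicit Arguments.
Unset Strict Implicit.
Unset Printing Implicit Defensive.

Import GRing.Theory.

Local Open Scope ring_scope.

Record sgraph := SGraph {
  vertex :> finType;
  edge : rel vertex;
  edge_sym : ssrbool.symmetric edge;
  edge_irr : irreflexive edge
}.

Definition sgraph_iso (G H : sgraph) : Prop :=
  exists2 f : G -> H, bijective f & forall a b, edge (f a) (f b) = edge a b.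

Section Constructions.

Definition union_edge (G H : sgraph) : rel (G + H)%type := fun a b =>
  match a, b with
  | inl a, inl b => edge a b
  | inr a, inr b => edge a b
  | _, _ => false
  end.

Lemma union_edge_sym (G H : sgraph) : ssrbool.symmetric (@union_edge G H).
Proof. by move=> [a|a] [b|b] //=; rewrite edge_sym. Qed.

Lemma union_edge_irr (G H : sgraph) : irreflexive (@union_edge G H).
Proof. by move=> [a|a] /=; rewrite edge_irr. Qed.

Definition disjoint_union (G H : sgraph) : sgraph :=
  SGraph (@union_edge_sym G H) (@union_edge_irr G H).

(* The vertex y of H is dropped from the vertex set: x plays its role. *)
Definition glue_edge (G H : sgraph) (x : G) (y : H) :
    rel (G + {z : H | z != y})%type := fun a b =>
  match a, b with
  | inl a, inl b => edge a b
  | inr a, inr b => edge (val a) (val b)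
  | inl a, inr b => (a == x) && edge y (val b)
  | inr a, inl b => (b == x) && edge y (val a)
  end.

Arguments glue_edge {G H} x y _ _.

Lemma glue_edge_sym (G H : sgraph) (x : G) (y : H) :
  ssrbool.symmetric (glue_edge x y).
Proof. by move=> [a|a] [b|b] //=; rewrite edge_sym. Qed.

Lemma glue_edge_irr (G H : sgraph) (x : G) (y : H) :
  irreflexive (glue_edge x y).
Proof. by move=> [a|a] /=; rewrite edge_irr. Qed.

Definition glue (G H : sgraph) (x : G) (y : H) : sgraph :=
  SGraph (@glue_edge_sym G H x y) (@glue_edge_irr G H x y).

Definition cone_edge (G : sgraph) : rel (option G) := fun a b =>
  match a, b with
  | Some a, Some b => edge a b
  | None, None => false
  | _, _ => true
  end.

Lemma cone_edge_sym (G : sgraph) : ssrbool.symmetric (@cone_edge G).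
Proof. by move=> [a|] [b|] //=; rewrite edge_sym. Qed.

Lemma cone_edge_irr (G : sgraph) : irreflexive (@cone_edge G).
Proof. by move=> [a|] //=; rewrite edge_irr. Qed.

Definition cone (G : sgraph) : sgraph :=
  SGraph (@cone_edge_sym G) (@cone_edge_irr G).

End Constructions.

(* The constructions above use specific vertex types, hence the rules    *)
(* closing both classes under isomorphism.                               *)
Inductive in_classG : sgraph -> Prop :=
| classG_one (G : sgraph) : #|G| = 1%N -> in_classG G
| classG_union (G H : sgraph) :
    in_classG G -> in_classG H -> in_classG (disjoint_union G H)
| classG_glue (G H : sgraph) (x : G) (y : H) :
    in_classG G -> in_classG H -> in_classG (glue x y)
| classG_cone (G : sgraph) : in_classG G -> in_classG (cone G)
| classG_iso (G H : sgraph) : sgraph_iso G H -> in_classG G -> in_classG H.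

Inductive trivially_perfect : sgraph -> Prop :=
| tperf_one (G : sgraph) : #|G| = 1%N -> trivially_perfect G
| tperf_union (G H : sgraph) :
    trivially_perfect G -> trivially_perfect H ->
    trivially_perfect (disjoint_union G H)
| tperf_cone (G : sgraph) : trivially_perfect G -> trivially_perfect (cone G)
| tperf_iso (G H : sgraph) :
    sgraph_iso G H -> trivially_perfect G -> trivially_perfect H.

(* Only meaningful when every member of the set has codimension one.     *)
Notation arrangement K n := {fset {vspace 'rV[K]_n}}.

Section Arrangements.

Variables (K : fieldType) (n : nat).
Implicit Types (A : arrangement K n) (X : {vspace 'rV[K]_n}).

Definition in_lattice A X : Prop :=
  exists2 B : arrangement K n, (B `<=` A)%fset & X = (\bigcap_(H <- B) H)%VS.

Definition center A : {vspace 'rV[K]_n} := (\bigcap_(H <- A) H)%VS.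

(* As a set of subspaces of K^n, each contained in X.                    *)
Definition restriction A X : arrangement K n :=
  [fset (H :&: X)%VS | H in A & ~~ (X <= H)%VS]%fset.

End Arrangements.

Section Freeness.

Variables (K : fieldType) (n : nat).
Local Notation S := {mpoly K[n]}.
Implicit Types (A : arrangement K n) (theta : S -> S).

Definition derivation theta : Prop :=
  (forall (c : K) (f g : S), theta (c *: f + g) = c *: theta f + theta g) /\
  (forall f g : S, theta (f * g) = theta f * g + f * theta g).

Definition linear_poly (alpha : 'Hom('rV[K]_n, K^o)) : S :=
  \sum_(i < n) (alpha (delta_mx 0 i) : K) *: 'X_i.

(* A form alpha_H is only determined by H up to a nonzero scalar, which  *)
(* does not affect the condition.                                        *)
Definition log_derivation A theta : Prop :=
  derivation theta /\
  forall alpha : 'Hom('rV[K]_n, K^o), lker alpha \in A ->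
    exists g : S, theta (linear_poly alpha) = linear_poly alpha * g.

(* Polynomial degree: d/dx_i has degree 0.                               *)
Definition homog_derivation (d : nat) theta : Prop :=
  forall i : 'I_n, theta 'X_i \is d.-homog.

Definition free_with_exponents A (e : seq nat) : Prop :=
  exists theta : 'I_(size e) -> (S -> S),
    [/\ forall k, log_derivation A (theta k),
        forall k : 'I_(size e), homog_derivation (nth 0%N e k) (theta k),
        forall eta, log_derivation A eta ->
          exists c : 'I_(size e) -> S,
            forall f, eta f = \sum_k c k * theta k f
      & forall c : 'I_(size e) -> S,
          (forall f, \sum_k c k * theta k f = 0) -> forall k, c k = 0].

End Freeness.

(* Freeness of an arrangement B in a d-dimensional subspace X of K^n, the *)
(* elements of B being given as subspaces of X.  X carries no preferred   *)
(* coordinates, so it is identified with K^d by a linear isomorphism phi; *)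
(* the choice of phi is immaterial because a linear change of coordinates *)
(* is a graded automorphism of the polynomial ring.                       *)
Definition free_in_with_exponents (K : fieldType) (n d : nat)
    (X : {vspace 'rV[K]_n}) (B : arrangement K n) (e : seq nat) : Prop :=
  exists phi : 'Hom('rV[K]_d, 'rV[K]_n),
    [/\ lker phi = 0%VS, limg phi = X
      & free_with_exponents [fset (phi @^-1: H)%VS | H in B]%fset e].

(* Every flat contains the center, so L(A) has no element of dimension d  *)
(* below dim (center A).  The flag therefore starts at that dimension,    *)
(* which amounts to passing to the essentialization and is no restriction *)
(* when the center has dimension at most one.                             *)
Definition flag_accurate (K : fieldType) (n : nat) (A : arrangement K n) :
    Prop :=
  exists e : seq nat,
    [/\ size e = n, sorted leq e, free_with_exponents A e
      & exists X : nat -> {vspace 'rV[K]_n},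
          (forall d, (0 < d)%N -> (\dim (center A) <= d <= n)%N ->
             [/\ in_lattice A (X d), \dim (X d) = d
               & free_in_with_exponents d (X d) (restriction A (X d))
                   (take d e)]) /\
          (forall d, (0 < d)%N -> (\dim (center A) <= d < n)%N ->
             (X d <= X d.+1)%VS)].

Section Graphic.

Variables (K : fieldType) (n : nat).

Definition coord_fun (i : 'I_n) (x : 'rV[K]_n) : K^o := x 0 i.

Lemma coord_fun_linear i : linear (coord_fun i).
Proof. by move=> c x y; rewrite /coord_fun !mxE. Qed.

HB.instance Definition _ i :=
  GRing.isLinear.Build K 'rV[K]_n K^o _ (coord_fun i) (coord_fun_linear i).

Definition coord_form (i : 'I_n) : 'Hom('rV[K]_n, K^o) := linfun (coord_fun i).

Definition diff_hyperplane (i j : 'I_n) : {vspace 'rV[K]_n} :=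
  lker (coord_form i - coord_form j).

Lemma mem_diff_hyperplane i j (x : 'rV[K]_n) :
  (x \in diff_hyperplane i j) = (x 0 i == x 0 j).
Proof. by rewrite memv_ker add_lfunE opp_lfunE !lfunE subr_eq0. Qed.

Lemma dim_diff_hyperplane i j : i != j -> (\dim (diff_hyperplane i j)).+1 = n.
Proof.
move=> ij; pose f := (coord_form i - coord_form j)%R.
have lim1 : \dim (limg f) = 1%N.
  apply/eqP; rewrite eqn_leq; apply/andP; split.
    by rewrite (leq_trans (dimvS (subvf _))) // dimvf.
  rewrite lt0n dimv_eq0; apply: contraNneq ij => lim0.
  have : f (delta_mx 0 i) \in limg f by rewrite memv_img ?memvf.
  rewrite lim0 memv0 add_lfunE opp_lfunE !lfunE /= /coord_fun !mxE !eqxx /=.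
  by rewrite [j == i]eq_sym; case: (eqVneq i j) => // _;
    rewrite subr0 oner_eq0.
have := limg_ker_dim f fullv.
by rewrite capfv lim1 addn1 dimvf dim_matrix => ->; exact: mul1n.
Qed.

Definition graphic_arrangement (G : sgraph) (v : 'I_n -> G) :
    arrangement K n :=
  [fset diff_hyperplane p.1 p.2 | p : 'I_n * 'I_n & edge (v p.1) (v p.2)]%fset.

End Graphic.

(* Main.v *)
(* Every graph of the class has a perfect elimination ordering: the earlier
   neighbours N_k of each vertex k form a clique.  Let D_k be the set of
   vertices reachable from k along ascending paths.  The clique condition forces
   every edge leaving D_k to end in N_k, so that
     theta_k = sum_(j in D_k) prod_(i in N_k) (x_j - x_i) d/dx_j
   is a logarithmic derivation; these derivations are triangular and the
   diagonal entry prod_(i in N_k) (x_k - x_i) divides the k-th component of any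
   logarithmic derivation killing the coordinates before k.  Hence they form a
   basis, and the exponents are the numbers |N_k|.

   The restriction of a graphic arrangement to a flat is the graphic arrangement
   of the contracted graph.  By induction on the construction, a graph of the
   class with an edge has an edge whose contraction is again in the class and
   has the same exponents, except that one largest exponent is removed; iterating
   until no edge is left gives the flag. *)

Require Import Defs.
From HB Require Import structures.
From mathcomp Require Import all_boot all_order all_algebra.
From mathcomp Require Import perm.
From mathcomp Require Import finmap mpoly.

Set Implicit Arguments.
Unset Strict Implicit.
Unset Printing Implicit Defensive.

Import GRing.Theory.

(** * Perfect elimination orderings *)

(** Pairs each graph with its multiset of exponents; the last rule makes the order of the list
    irrelevant. Edgeless graphs of any size, even empty, replace single vertices: contracting an
    edge of a star leaves a cone over a smaller edgeless graph. Gluing merges two vertices, which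
    costs one zero exponent. *)
Inductive class_exponents : sgraph -> seq nat -> Prop :=
| class_exponents_edgeless (G : sgraph) :
    (forall a b : G, ~~ edge a b) -> class_exponents G (nseq #|G| 0)
| class_exponents_union (G H : sgraph) e1 e2 :
    class_exponents G e1 -> class_exponents H e2 ->
    class_exponents (disjoint_union G H) (e1 ++ e2)
| class_exponents_glue (G H : sgraph) (x : G) (y : H) e1 e2 :
    class_exponents G (0 :: e1) -> class_exponents H (0 :: e2) ->
    class_exponents (glue x y) (0 :: e1 ++ e2)
| class_exponents_cone (G : sgraph) e :
    class_exponents G e -> class_exponents (cone G) (0 :: map S e)
| class_exponents_iso (G H : sgraph) e :
    sgraph_iso G H -> class_exponents G e -> class_exponents H e
| class_exponents_perm (G : sgraph) e1 e2 :
    perm_eq e1 e2 -> class_exponents G e1 -> class_exponents G e2.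

(** The zero is displayed because the gluing rule consumes one on each side. *)
Lemma in_classG_exponents (G : sgraph) :
  in_classG G -> exists e, class_exponents G (0 :: e).
Proof.
elim=> {G} [G G1|G H _ [e1 h1] _ [e2 h2]|G H x y _ [e1 h1] _ [e2 h2]
  |G _ [e h]|G H GH _ [e h]].
- exists [::]; rewrite -[[:: 0]]/(nseq 1 0) -G1; apply: class_exponents_edgeless => a b.
  have /card_le1P GP : #|G| <= 1 by rewrite G1.
  have : b \in pred1 a by rewrite -(GP a).
  by rewrite inE => /eqP->; rewrite edge_irr.
- by exists (e1 ++ 0 :: e2); exact: (class_exponents_union h1 h2).
- by exists (e1 ++ e2); exact: class_exponents_glue.
- by exists (map S (0 :: e)); exact: class_exponents_cone.
- by exists e; exact: class_exponents_iso h.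
Qed.

Lemma trivially_perfect_in_classG (G : sgraph) :
  trivially_perfect G -> in_classG G.
Proof.
elim=> {G} [G G1|G H _ h1 _ h2|G _ h|G H GH _ h].
- exact: classG_one.
- exact: classG_union.
- exact: classG_cone.
- exact: classG_iso h.
Qed.

(* Lists of vertices are read from right to left: the head is the vertex
   added last, and its exponent counts its neighbours in the tail. *)
Section Elimination.
Variable G : sgraph.
Implicit Types s t : seq G.

Fixpoint perfect s : Prop :=
  if s is k :: s' then
    {in s' &, forall a b, edge k a -> edge k b -> a != b -> edge a b}
    /\ perfect s'
  else True.

Fixpoint back_degrees s : seq nat :=
  if s is k :: s' then count (edge k) s' :: back_degrees s' else [::].

Definition elimination s (e : seq nat) :=
  [/\ uniq s, s =i G, perfect s & perm_eq e (back_degrees s)].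

(** Gluing needs an ordering that starts at the glued vertex, so one is demanded for every starting
    vertex. The first clause keeps the notion meaningful for the empty graph, where the second is
    vacuous. *)
Definition elimination_from_any e :=
  (exists s, elimination s e) /\ forall x, exists t, elimination (rcons t x) e.

Lemma size_back_degrees s : size (back_degrees s) = size s.
Proof. by elim: s => //= k s ->. Qed.

Lemma back_degrees_rcons t x :
  exists d, back_degrees (rcons t x) = rcons d 0.
Proof.
elim: t => [|k t [d E]] /=; first by exists [::].
by exists (count (edge k) (rcons t x) :: d); rewrite E.
Qed.

Lemma size_elimination s e : elimination s e -> size e = #|G|.
Proof.
case=> u sG _ /perm_size->; rewrite size_back_degrees -(card_uniqP u).
by apply: eq_card => z; rewrite sG.
Qed.

(** The first two vertices of an ordering can trade places when adjacent: later vertices see the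
    same set before them, and the two exponents remain 0 and 1. *)
Lemma swap_tail t a b : edge a b ->
  perfect (t ++ [:: a; b]) ->
  perfect (t ++ [:: b; a]) /\
  back_degrees (t ++ [:: b; a]) = back_degrees (t ++ [:: a; b]).
Proof.
move=> ab; have pab u : perm_eq (u ++ [:: a; b]) (u ++ [:: b; a]).
  by rewrite perm_cat2l (perm_catC [:: a] [:: b]).
elim: t => [_|k t IH /= [h /IH[p ->]]] /=.
  split; last by rewrite edge_sym.
  by split=> // c d; rewrite !inE => /eqP-> /eqP->; rewrite eqxx.
rewrite (seq.permP (pab t)); split=> //; split=> // c d ct dt.
by apply: h; rewrite (perm_mem (pab t)).
Qed.

(** Restates the recursive clique condition through positions; a smaller index means a vertex added
    later. *)
Lemma perfect_index s a b k : perfect s ->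
  index k s < index a s -> index k s < index b s ->
  a \in s -> b \in s -> edge k a -> edge k b -> a != b -> edge a b.
Proof.
elim: s => //= k' s IH [h p]; rewrite ![k' == _]eq_sym.
case: (eqVneq a k') => // ak'; case: (eqVneq b k') => // bk'.
rewrite !inE (negPf ak') (negPf bk') /=.
case: (eqVneq k k') => [-> _ _|_]; first exact: h.
by rewrite !ltnS; exact: IH.
Qed.

Lemma back_degrees_index s : uniq s ->
  back_degrees s =
    [seq count (fun z => edge k z && (index k s < index z s)) s | k <- s].
Proof.
elim: s => //= k s IH /andP[ks us]; rewrite eqxx ltnn andbF add0n.
congr (_ :: _).
  apply: eq_in_count => z zs; case: eqVneq => [kz|_]; last by rewrite andbT.
  by rewrite kz zs in ks.
rewrite IH //; apply/eq_in_map => z zs /=.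
have kz : (k == z) = false by apply: contraNF ks => /eqP->.
rewrite kz ltn0 andbF add0n; apply: eq_in_count => w ws.
have kw : (k == w) = false by apply: contraNF ks => /eqP->.
by rewrite kw ltnS.
Qed.

End Elimination.

Section Extension.
Variables (H T : sgraph) (j : H -> T) (w : seq H) (u : seq T).
Hypothesis j_edge : forall a b, edge (j a) (j b) = edge a b.
Hypothesis u_perf : perfect u.

(** The list [w] stands for the part of [H] that [u] already represents: the vertices of [t] have as
    many neighbours in [u] as in [w], and these come from [w]. So cliques and counts carry over when
    [t] is added after [u]. For a disjoint union [w] is empty; for a gluing it is the glued vertex
    alone. *)
Lemma perfect_extend t : injective j ->
  {in t, forall k, count (edge (j k)) u = count (edge k) w} ->
  {in t & u, forall k b, edge (j k) b -> exists2 y, y \in w & b = j y} ->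
  perfect (t ++ w) ->
  perfect (map j t ++ u) /\
  exists d, back_degrees (t ++ w) = d ++ back_degrees w /\
            back_degrees (map j t ++ u) = d ++ back_degrees u.
Proof.
move=> j_inj; elim: t => [_ _ _|k t IH hc hn /= [h p]] /=.
  by split=> //; exists [::].
have [|||p' [d [E1 E2]]] := IH.
- by move=> z zt; apply: hc; rewrite inE zt orbT.
- by move=> z b zt; apply: hn; rewrite inE zt orbT.
- by [].
split; last first.
  exists (count (edge k) (t ++ w) :: d); rewrite E1 E2; split=> //.
  rewrite !count_cat count_map hc ?mem_head //=; congr (_ + _ :: _).
  by apply: eq_count => z /=; rewrite j_edge.
split=> // a b ha hb ka kb.
have lift c : c \in map j t ++ u -> edge (j k) c ->
    exists2 z, z \in t ++ w & c = j z.
  rewrite mem_cat => /orP[/mapP[z zt ->] _|cu kc].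
    by exists z => //; rewrite mem_cat zt.
  have [z zw ->] := hn k c (mem_head _ _) cu kc.
  by exists z => //; rewrite mem_cat zw orbT.
have [a' a't Ea] := lift a ha ka; have [b' b't Eb] := lift b hb kb.
move: ka kb; rewrite Ea Eb !j_edge (inj_eq j_inj); exact: h.
Qed.

End Extension.

Lemma perfect_map (H T : sgraph) (j : H -> T) s : injective j ->
  (forall a b, edge (j a) (j b) = edge a b) -> perfect s ->
  perfect (map j s) /\ back_degrees (map j s) = back_degrees s.
Proof.
move=> j_inj je ps.
have [|||p [d []]] := @perfect_extend H T j [::] [::] je I s j_inj.
- by [].
- by [].
- by rewrite cats0.
by move: p; rewrite /= !cats0 => p -> ->.
Qed.

(** * Elimination orderings through the graph constructions *)

Lemma elimination_edgeless (G : sgraph) :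
  (forall a b : G, ~~ edge a b) -> elimination_from_any G (nseq #|G| 0).
Proof.
move=> ne.
have P (s : seq G) : uniq s -> s =i G -> elimination s (nseq #|G| 0).
  move=> us sG; split=> //.
    elim: s {us sG} => //= k s IH; split=> // a b _ _ ka.
    by case/negP: (ne k a).
  have -> : #|G| = size s.
    by rewrite -(card_uniqP us); apply: eq_card => z; rewrite sG.
  rewrite (_ : back_degrees s = nseq (size s) 0) //.
  elim: s {us sG} => //= k s ->; congr (_ :: _).
  by apply/eqP; rewrite -leqn0 leqNgt -has_count; apply/hasPn => z _ /=.
split.
  by exists (enum G); apply: P; [exact: enum_uniq | move=> z; rewrite mem_enum].
move=> x; exists (rem x (enum G)); apply: P.
  by rewrite rcons_uniq mem_rem_uniq ?enum_uniq // !inE eqxx /= rem_uniq ?enum_uniq.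
by move=> z; rewrite mem_rcons inE mem_rem_uniq ?enum_uniq // !inE mem_enum; case: eqVneq.
Qed.

(** With the apex added first, every other vertex gains exactly one earlier neighbour, and that
    neighbour is adjacent to all others. *)
Lemma elimination_cone (G : sgraph) e :
  elimination_from_any G e ->
  elimination_from_any (cone G) (0 :: map S e).
Proof.
move=> [[s0 h0] hx].
have P (s : seq G) : elimination s e ->
    elimination (G := cone G) (rcons (map Some s) None) (0 :: map S e).
  case=> us sG ps pe.
  have [p E] : perfect (G := cone G) (rcons (map Some s) None) /\
      back_degrees (G := cone G) (rcons (map Some s) None) =
      rcons (map S (back_degrees s)) 0.
    elim: s ps {us sG pe} => [_|k s IH /= [h /IH [p ->]]] /=; first by split.
    split; last first.
      by rewrite -cats1 count_cat count_map /= addn0 addn1; congr (_.+1 :: _).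
      split=> // a b; rewrite !mem_rcons !inE.
    case: a => [a|]; case: b => [b|] //=.
    by rewrite !(mem_map (@Some_inj _)); exact: h.
  split=> //.
  - by rewrite rcons_uniq map_inj_uniq ?us ?andbT; [apply/mapP; case | exact: Some_inj].
  - move=> [z|]; rewrite mem_rcons inE //=.
    by rewrite mem_map ?sG //; exact: Some_inj.
  - by rewrite E perm_sym perm_rcons perm_cons perm_map // perm_sym.
split; first by eexists; exact: P h0.
move=> [x|]; last by exists (map Some s0); exact: P.
(* To start at [x], begin with the apex followed by [x]; these are adjacent and can be swapped. *)
have [t ht] := hx x; have [us sG ps pe] := P _ ht.
have sh : rcons (map Some (rcons t x)) None =
    map Some t ++ [:: Some x; None] by rewrite map_rcons -!cats1 -catA.
rewrite sh in us sG ps pe.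
have [|p E] := @swap_tail (cone G) _ _ _ _ ps; first by [].
have pm : perm_eq (map Some t ++ [:: Some x; None]) (map Some t ++ [:: None; Some x]).
  by rewrite perm_cat2l (perm_catC [:: _] [:: _]).
exists (rcons (map Some t) None); rewrite -!cats1 -catA; split=> //.
- by rewrite -(perm_uniq pm).
- by move=> z; rewrite -(perm_mem pm).
- by rewrite E.
Qed.

(** No edge joins the two sides, so either may be placed first; this allows a start on either
    side. *)
Lemma elimination_union (G H : sgraph) e1 e2 :
  elimination_from_any G e1 -> elimination_from_any H e2 ->
  elimination_from_any (disjoint_union G H) (e1 ++ e2).
Proof.
set T := disjoint_union G H => -[[s1 h1] h1x] [[s2 h2] h2x].
have inlI : injective (inl : G -> T) by move=> a b [].
have inrI : injective (inr : H -> T) by move=> a b [].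
have P a b : elimination a e1 -> elimination b e2 ->
    elimination (G := T) (map inr b ++ map inl a) (e1 ++ e2)
    /\ elimination (G := T) (map inl a ++ map inr b) (e1 ++ e2).
  case=> ua aG pa ea [ub bG pb eb].
  have [pla ela] := @perfect_map G T inl a inlI (fun _ _ => erefl) pa.
  have [prb erb] := @perfect_map H T inr b inrI (fun _ _ => erefl) pb.
  have dis : ~~ has (mem (map (inr : H -> T) b)) (map (inl : G -> T) a).
    by apply/hasPn => _ /mapP[z _ ->]; apply/negP => /mapP[].
  have cov (z : T) : (z \in map inl a) || (z \in map inr b).
    by case: z => z; [rewrite mem_map ?aG | rewrite orbC mem_map ?bG].
  have [|||prl [d []]] :=
      @perfect_extend H T inr [::] (map inl a) (fun _ _ => erefl) pla b inrI.
  - by move=> k _; rewrite count_map /=; elim: (a).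
  - by move=> k _ _ /mapP[z _ ->].
  - by rewrite cats0.
  rewrite !cats0 => <- Erl.
  have [|||plr [d' []]] :=
      @perfect_extend G T inl [::] (map inr b) (fun _ _ => erefl) prb a inlI.
  - by move=> k _; rewrite count_map /=; elim: (b).
  - by move=> k _ _ /mapP[z _ ->].
  - by rewrite cats0.
  rewrite !cats0 => <- Elr.
  split; split=> //.
  - by rewrite cat_uniq !map_inj_uniq // ub ua dis.
  - by move=> z; rewrite mem_cat orbC cov.
  - by rewrite Erl ela perm_catC perm_cat.
  - by rewrite uniq_catC cat_uniq !map_inj_uniq // ub ua dis.
  - by move=> z; rewrite mem_cat cov.
  - by rewrite Elr erb perm_cat.
split; first by exists (map inl s1 ++ map inr s2); case: (P _ _ h1 h2).
case=> x.
  have [t ht] := h1x x; exists (map inr s2 ++ map inl t).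
  by rewrite rcons_cat -map_rcons; case: (P _ _ ht h2).
have [t ht] := h2x x; exists (map inl s1 ++ map inr t).
by rewrite rcons_cat -map_rcons; case: (P _ _ h1 ht).
Qed.

Section Glue.
Variables (G H : sgraph) (x : G) (y : H).
Local Notation T := (glue x y).

(** The embedding of [H] into the glued graph. It restores the symmetry between the two graphs that
    the choice of vertex type breaks. *)
Definition glue_r (z : H) : T :=
  if insub z is Some z' then inr z' else inl x.

Lemma glue_r_root : glue_r y = inl x.
Proof. by rewrite /glue_r insubF // eqxx. Qed.

Lemma glue_r_val (z : {z : H | z != y}) : glue_r (val z) = inr z.
Proof. by rewrite /glue_r valK. Qed.

Lemma glue_r_spec z : (z = y /\ glue_r z = inl x) \/
  exists2 z' : {z : H | z != y}, z = val z' & glue_r z = inr z'.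
Proof.
case: (eqVneq z y) => [->|zy]; first by left; rewrite glue_r_root.
by right; exists (Sub z zy); rewrite -?glue_r_val.
Qed.

Lemma glue_r_edge a b : edge (glue_r a) (glue_r b) = edge a b.
Proof.
case: (glue_r_spec a) => [[-> ->]|[a' -> ->]];
case: (glue_r_spec b) => [[-> ->]|[b' -> ->]] //=.
- by rewrite !edge_irr.
- by rewrite eqxx.
- by rewrite eqxx /= edge_sym.
Qed.

Lemma glue_r_inj : injective glue_r.
Proof.
move=> a b; case: (glue_r_spec a) => [[-> ->]|[a' -> ->]];
by case: (glue_r_spec b) => [[-> ->]|[b' -> ->]] // [->].
Qed.

Lemma glue_r_edge_inl k b :
  k != y -> edge (glue_r k) (inl b : T) = (b == x) && edge y k.
Proof. by case: (glue_r_spec k) => [[->]|[k' -> ->]] //; rewrite eqxx. Qed.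

Lemma inl_eq_glue_r a k : ((inl a : T) == glue_r k) = (a == x) && (k == y).
Proof.
apply/eqP/andP => [|[/eqP-> /eqP->]]; last by rewrite glue_r_root.
by case: (glue_r_spec k) => [[-> ->] [->]|[k' _ ->]].
Qed.

End Glue.

Lemma count_and_eq (T : eqType) (x : T) (P : bool) s : uniq s -> x \in s ->
  count (fun b => (b == x) && P) s = P.
Proof.
move=> us xs; case: P.
  under eq_count do rewrite andbT.
  by rewrite (count_uniq_mem x us) xs.
by under eq_count do rewrite andbF; rewrite count_pred0.
Qed.

(** One graph is placed completely; the other follows in an ordering that starts at the glued
    vertex, which is already present. Its remaining vertices meet the first graph only in that
    vertex, so their exponents do not change. *)
Lemma elimination_glue (G H : sgraph) (x : G) (y : H) e1 e2 :
  elimination_from_any G (0 :: e1) -> elimination_from_any H (0 :: e2) ->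
  elimination_from_any (glue x y) (0 :: e1 ++ e2).
Proof.
set T := glue x y; set j := @glue_r G H x y.
move=> [[s1 h1] h1x] [[s2 h2] h2x].
have inlI : injective (inl : G -> T) by move=> a b [].
have jI : injective j by exact: glue_r_inj.
have jE := @glue_r_edge G H x y : forall a b, edge (j a) (j b) = edge a b.
(* The starting vertex has exponent 0, and this is the zero that gluing drops. *)
have perm_tail (K : sgraph) t (z : K) d :
    perm_eq (0 :: d) (back_degrees (rcons t z)) ->
    exists2 d', perm_eq d d' & back_degrees (t ++ [:: z]) = d' ++ [:: 0].
  rewrite cats1; have [d' ->] := back_degrees_rcons t z.
  rewrite perm_sym perm_rcons perm_cons perm_sym => p.
  by exists d' => //; rewrite cats1.
have cov (z : T) a b : a =i G -> b =i H -> (z \in map inl a) || (z \in map j b).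
  move=> aG bH; case: z => z; first by rewrite mem_map ?aG.
  by rewrite orbC -glue_r_val mem_map ?bH.
(* [P] places [G] first and [Q] below places [H] first, so that every vertex can be the start. *)
have P a t : elimination a (0 :: e1) -> elimination (rcons t y) (0 :: e2) ->
    elimination (G := T) (map j t ++ map inl a) (0 :: e1 ++ e2).
  case=> ua aG pa ea [ub bG pb /perm_tail[d' pd Ed]].
  have [pla ela] := @perfect_map G T inl a inlI (fun _ _ => erefl) pa.
  move: ub bG pb; rewrite -cats1 cat_uniq /= orbF andbT => /andP[ub yt] bG pb.
  have [|||p [d [E1 E2]]] :=
      @perfect_extend H T j [:: y] (map inl a) jE pla t jI.
  - move=> k kt; rewrite count_map /= addn0 -(@count_and_eq _ x (edge k y) a) //.
    rewrite edge_sym; apply: eq_count => b.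
    by apply: glue_r_edge_inl; apply: contraNneq yt => <-.
  - move=> k _ kt /mapP[b ba ->]; rewrite glue_r_edge_inl.
      by case/andP=> /eqP-> _; exists y; rewrite ?inE // /j glue_r_root.
    by apply: contraNneq yt => <-.
  - by [].
  split=> //.
  - rewrite cat_uniq !map_inj_uniq // ub ua andbT /=.
    apply/hasPn => _ /mapP[b ba ->]; apply/negP => /mapP[k kt /eqP].
    by rewrite inl_eq_glue_r => /andP[_ /eqP ky]; rewrite -ky kt in yt.
  - move=> z; rewrite mem_cat orbC.
    have := cov z _ _ aG bG; rewrite map_cat mem_cat inE /= /j glue_r_root.
    have xa : inl x \in map (inl : G -> T) a by rewrite mem_map ?aG.
    by case/or3P => [->|->|/eqP->] //; rewrite ?orbT // xa.
  have Ed' : d = d' by move: E1; rewrite Ed !cats1 => /rcons_inj[].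
  by rewrite E2 Ed' ela perm_sym perm_catC perm_sym -cat_cons perm_cat.
have Q t b : elimination (rcons t x) (0 :: e1) -> elimination b (0 :: e2) ->
    elimination (G := T) (map inl t ++ map j b) (0 :: e1 ++ e2).
  case=> ua aG pa /perm_tail[d' pd Ed] [ub bG pb eb].
  have [prb erb] := @perfect_map H T j b jI jE pb.
  move: ua aG pa; rewrite -cats1 cat_uniq /= orbF andbT => /andP[ua xt] aG pa.
  have nb k z : k != x -> edge (inl k : T) (j z) = (z == y) && edge x k.
    move=> kx; rewrite edge_sym.
    case: (eqVneq z y) => [->|zy]; first by rewrite /j glue_r_root.
    by rewrite glue_r_edge_inl // (negPf kx).
  have [|||p [d [E1 E2]]] :=
      @perfect_extend G T inl [:: x] (map j b) (fun _ _ => erefl) prb t inlI.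
  - move=> k kt; rewrite count_map /= addn0 -(@count_and_eq _ y (edge k x) b) //.
    rewrite edge_sym; apply: eq_count => z.
    by apply: nb; apply: contraNneq xt => <-.
  - move=> k _ kt /mapP[z zb ->]; rewrite nb.
      by case/andP=> /eqP-> _; exists x; rewrite ?inE // /j glue_r_root.
    by apply: contraNneq xt => <-.
  - by [].
  split=> //.
  - rewrite cat_uniq !map_inj_uniq // ub ua andbT /=.
    apply/hasPn => _ /mapP[z zb ->]; apply/negP => /mapP[k kt /esym/eqP].
    by rewrite inl_eq_glue_r => /andP[/eqP kx _]; rewrite -kx kt in xt.
  - move=> z; rewrite mem_cat.
    have := cov z _ _ aG bG; rewrite map_cat mem_cat inE /=.
    have xb : inl x \in map j b by rewrite -(@glue_r_root G H x y) mem_map ?bG.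
    by case/orP=> [/orP[->|/eqP->]|->] //; rewrite ?orbT // xb orbT.
  have Ed' : d = d' by move: E1; rewrite Ed !cats1 => /rcons_inj[].
  rewrite E2 Ed' erb; apply: (@perm_trans _ (e1 ++ 0 :: e2)).
    by rewrite -cat1s -[0 :: e2]cat1s perm_catCA.
  exact: perm_cat.
have [ty hy] := h2x y.
split; first by exists (map j ty ++ map inl s1); exact: P.
case=> z.
  have [t ht] := h1x z; exists (map j ty ++ map inl t).
  by rewrite rcons_cat -map_rcons; exact: P.
have [t ht] := h2x (val z); have [tx hx] := h1x x; exists (map inl tx ++ map j t).
by rewrite rcons_cat -[inr z]glue_r_val -map_rcons; exact: Q.
Qed.

Lemma elimination_iso (G H : sgraph) e : sgraph_iso G H ->
  elimination_from_any G e -> elimination_from_any H e.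
Proof.
case=> f [g fK gK] fE; have fI := can_inj fK.
have P s : elimination s e -> elimination (map f s) e.
  case=> us sG ps pe; have [p E] := perfect_map fI fE ps.
  split=> //; first by rewrite map_inj_uniq.
    by move=> z; rewrite -[z]gK mem_map // sG.
  by rewrite E.
case=> -[s hs] hx; split; first by exists (map f s); exact: P.
by move=> z; have [t /P] := hx (g z); rewrite map_rcons gK; exists (map f t).
Qed.

Lemma class_exponents_elimination (G : sgraph) e :
  class_exponents G e -> elimination_from_any G e.
Proof.
elim=> {G e} [G ne|G H e1 e2 _ h1 _ h2|G H x y e1 e2 _ h1 _ h2|G e _ h
  |G H e GH _ h|G e1 e2 e12 _ h].
- exact: elimination_edgeless.
- exact: elimination_union.
- exact: elimination_glue.
- exact: elimination_cone.
- exact: elimination_iso h.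
- have P s : elimination s e1 -> elimination s e2.
    by case=> us sG ps pe; split=> //; rewrite perm_sym in e12; exact: perm_trans pe.
  by case: h => -[s /P hs] hx; split=> [|x]; [exists s
    | have [t /P ht] := hx x; exists t].
Qed.

Lemma class_exponents_size (G : sgraph) e : class_exponents G e -> size e = #|G|.
Proof. by case/class_exponents_elimination => -[s /size_elimination]. Qed.

(** Each edge is counted in the exponent of its later endpoint. *)
Lemma class_exponents_zero_edgeless (G : sgraph) e (a b : G) :
  class_exponents G e -> all (eq_op^~ 0) e -> ~~ edge a b.
Proof.
case/class_exponents_elimination => -[s [us sG _ pe]] _; rewrite (perm_all _ pe) => h.
have {h} : {in s &, forall a b, ~~ edge a b}.
  elim: s {us sG pe} h => //= k s IH /andP[/eqP k0 /IH h] c d.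
  have nk z : z \in s -> ~~ edge k z.
    move=> zs; apply: contra_eqN k0 => kz.
    by rewrite -lt0n -has_count; apply/hasP; exists z.
  rewrite !inE => /orP[/eqP->|cs] /orP[/eqP->|ds]; first by rewrite edge_irr.
  - exact: nk.
  - by rewrite edge_sym nk.
  - exact: h.
by apply; rewrite sG.
Qed.

(** * Contractions *)

(* The last clause expresses that the fibers of f are connected. *)
Definition contraction (G G' : sgraph) (f : G -> G') : Prop :=
  [/\ forall a', exists a, f a = a',
      forall a b, edge a b -> f a = f b \/ edge (f a) (f b),
      forall a' b', edge a' b' -> exists a b, [/\ f a = a', f b = b' & edge a b]
    & forall (S : Type) (x : G -> S),
        (forall a b, edge a b -> f a = f b -> x a = x b) ->
        forall a b, f a = f b -> x a = x b].

Lemma contraction_id (G : sgraph) : contraction (@id G).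
Proof.
split=> [a|a b ab|a b ab|S x _ a b -> //]; first by exists a.
- by right.
- by exists a, b.
Qed.

Lemma contraction_comp (G G' G'' : sgraph) (f : G -> G') (g : G' -> G'') :
  contraction f -> contraction g -> contraction (g \o f).
Proof.
case=> fS fE fL fC [gS gE gL gC]; split=> [c|a b ab|a b /gL|S x xc a b ab].
- by have [b <-] := gS c; have [a <-] := fS b; exists a.
- by case: (fE _ _ ab) => [/= ->|/gE //]; left.
- move=> [a' [b' [<- <- /fL[a1 [b1 [<- <- ab]]]]]].
  by exists a1, b1.
have xf u v : f u = f v -> x u = x v.
  by apply: fC => c d cd /= fcd; apply: xc; rewrite //= fcd.
(* Since [x] is constant on the fibers of [f], it descends to [G'] along a section [h] of [f]; the
   fiber condition for [g] then applies to the descended function. *)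
have [h hf] : {h : G' -> G | forall c, f (h c) = c}.
  have fS' c : exists a, f a == c by have [u <-] := fS c; exists u.
  by exists (fun c => xchoose (fS' c)) => c; apply/eqP; exact: (xchooseP (fS' c)).
rewrite (xf a (h (f a))) ?hf // (xf b (h (f b))) ?hf //.
apply: (gC _ (x \o h)) => // c d /fL[u [v [fu fv uv]]] gcd /=.
rewrite -(xf u (h c)) ?hf // -(xf v (h d)) ?hf //; apply: xc => //=.
by rewrite fu fv.
Qed.

(** Fibers are only asked to be cliques, a condition that passes easily through the constructions.
    That exactly one vertex disappears is read off the exponents instead. *)
Definition edge_contraction (G G' : sgraph) (f : G -> G') : Prop :=
  [/\ forall a', exists a, f a = a',
      forall a b, edge a b -> f a = f b \/ edge (f a) (f b),
      forall a' b', edge a' b' -> exists a b, [/\ f a = a', f b = b' & edge a b]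
    & forall a b, f a = f b -> a = b \/ edge a b].

Lemma edge_contraction_contraction (G G' : sgraph) (f : G -> G') :
  edge_contraction f -> contraction f.
Proof.
case=> fS fE fL fC; split=> // S x xc a b fab.
by case: (fC _ _ fab) => [->//|ab]; apply: xc.
Qed.

(** * Edge contractions through the graph constructions *)

Lemma edge_contraction_union_l (G G' H : sgraph) (f : G -> G') :
  edge_contraction f -> edge_contraction (G := disjoint_union G H)
    (G' := disjoint_union G' H)
    (fun t => match t with inl a => inl (f a) | inr b => inr b end).
Proof.
case=> fS fE fL fC; split.
- by case=> z; [have [a <-] := fS z; exists (inl a) | exists (inr z)].
- case=> a [] b //=; last by right.
  by case/fE => [->|]; [left | right].
- case=> a [] b //=; last by exists (inr a), (inr b).
  by case/fL => u [v [<- <- uv]]; exists (inl u), (inl v).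
- case=> a [] b //= [] => [/fC[->|]|->]; by [left | right].
Qed.

Lemma edge_contraction_union_r (G H H' : sgraph) (f : H -> H') :
  edge_contraction f -> edge_contraction (G := disjoint_union G H)
    (G' := disjoint_union G H')
    (fun t => match t with inl a => inl a | inr b => inr (f b) end).
Proof.
case=> fS fE fL fC; split.
- by case=> z; [exists (inl z) | have [a <-] := fS z; exists (inr a)].
- case=> a [] b //=; first by right.
  by case/fE => [->|]; [left | right].
- case=> a [] b //=; first by exists (inl a), (inl b).
  by case/fL => u [v [<- <- uv]]; exists (inr u), (inr v).
- case=> a [] b //= [] => [->|/fC[->|]]; by [left | right].
Qed.

Lemma edge_contraction_cone (G G' : sgraph) (f : G -> G') :
  edge_contraction f ->
  edge_contraction (G := cone G) (G' := cone G') (omap f).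
Proof.
case=> fS fE fL fC; split.
- by case=> [z|]; [have [a <-] := fS z; exists (Some a) | exists None].
- move=> [a|] [b|] //=; try by right.
  by case/fE => [->|]; [left | right].
- move=> [a|] [b|] //=.
  + by case/fL => u [v [<- <- uv]]; exists (Some u), (Some v).
  + by have [u <-] := fS a; exists (Some u), None.
  + by have [u <-] := fS b; exists None, (Some u).
- move=> [a|] [b|] //=; last by left.
  by case=> /fC[->|]; [left | right].
Qed.

Lemma edge_contraction_glue_l (G G' H : sgraph) (f : G -> G') x y :
  edge_contraction f -> edge_contraction (G := @glue G H x y)
    (G' := @glue G' H (f x) y)
    (fun t => match t with inl a => inl (f a) | inr b => inr b end).
Proof.
case=> fS fE fL fC; split.
- by case=> z; [have [a <-] := fS z; exists (inl a) | exists (inr z)].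
- case=> a [] b //=.
  + by case/fE => [->|]; [left | right].
  + by case/andP=> /eqP->; rewrite eqxx; right.
  + by case/andP=> /eqP->; rewrite eqxx; right.
  + by right.
- case=> a [] b /=.
  + by case/fL => u [v [<- <- uv]]; exists (inl u), (inl v).
  + by case/andP=> /eqP-> yb; exists (inl x), (inr b); rewrite /= eqxx.
  + by case/andP=> /eqP-> yb; exists (inr a), (inl x); rewrite /= eqxx.
  + by exists (inr a), (inr b).
- case=> a [] b //= [] => [/fC[->|]|->]; by [left | right].
Qed.

(** A vertex of [H] may be merged with the root [y] and then has to land on [inl x]; hence the map
    passes through [glue_r]. *)
Lemma edge_contraction_glue_r (G H H' : sgraph) (f : H -> H') x y :
  edge_contraction f -> edge_contraction (G := @glue G H x y)
    (G' := @glue G H' x (f y))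
    (fun t => match t with inl a => inl a
              | inr b => @glue_r G H' x (f y) (f (val b)) end).
Proof.
case=> fS fE fL fC; set F := (F in edge_contraction F).
pose j := @glue_r G H x y; pose j' := @glue_r G H' x (f y).
have jy : j y = inl x by exact: glue_r_root.
have jy' : j' (f y) = inl x by exact: glue_r_root.
(* On the embedded copies of [H] and [H'] the map is [f] itself, so every case that touches [H]
   reduces to a property of [f]. *)
have Fj u : F (j u) = j' (f u).
  by case: (@glue_r_spec G H x y u) => [[-> E]|[u' -> E]]; rewrite /j E /=.
have jv z : j (val z) = inr z by exact: glue_r_val.
have jv' z : j' (val z) = inr z by exact: glue_r_val.
have jE a b : edge (j a) (j b) = edge a b by exact: glue_r_edge.
have jE' a b : edge (j' a) (j' b) = edge a b by exact: glue_r_edge.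
have jI' : injective j' by exact: glue_r_inj.
have jfE a b : edge a b -> F (j a) = F (j b) \/ edge (F (j a)) (F (j b)).
  by rewrite !Fj jE' => /fE[->|]; [left | right].
have jfL a b : edge a b -> exists u v, [/\ F u = j' a, F v = j' b & edge u v].
  by case/fL => u [v [<- <- uv]]; exists (j u), (j v); rewrite !Fj jE.
have jfC a b : F (j a) = F (j b) -> j a = j b \/ edge (j a) (j b).
  by rewrite !Fj jE => /jI'/fC[->|]; [left | right].
split.
- case=> z; first by exists (inl z).
  by have [u E] := fS (val z); exists (j u); rewrite Fj E jv'.
- case=> a [] b.
  + by right.
  + case/andP=> /eqP-> yb; rewrite -jy -jv; exact: jfE.
  + case/andP=> /eqP->; rewrite edge_sym => yb; rewrite -jy -jv; exact: jfE.
  + by rewrite -!jv jE => /jfE.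
- case=> a [] b.
  + by exists (inl a), (inl b).
  + by case/andP=> /eqP-> yb; rewrite -jy' -jv'; exact: jfL.
  + by case/andP=> /eqP->; rewrite edge_sym -jy' -jv' => yb; exact: jfL.
  + by rewrite -!jv' jE' => /jfL.
- case=> a [] b.
  + by case=> ->; left.
  + rewrite -jv Fj => E; have := E; rewrite /F => /eqP.
    by rewrite inl_eq_glue_r => /andP[/eqP ax _]; move: E;
      rewrite ax -jy -Fj; exact: jfC.
  + rewrite -jv Fj => E; have := esym E; rewrite /F => /eqP.
    by rewrite inl_eq_glue_r => /andP[/eqP ax _]; move: E;
      rewrite ax -jy -Fj; exact: jfC.
  + by rewrite -!jv; exact: jfC.
Qed.

Lemma edge_contraction_iso (G H G' : sgraph) (f : G -> G') :
  sgraph_iso G H -> edge_contraction f ->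
  exists f' : H -> G', edge_contraction f'.
Proof.
case=> h [g hK gK] hE [fS fE fL fC].
have gE a b : edge (g a) (g b) = edge a b by rewrite -hE !gK.
exists (f \o g); split.
- by move=> z; have [a <-] := fS z; exists (h a); rewrite /= hK.
- by move=> a b; rewrite -gE => /fE.
- by move=> a b /fL[u [v [<- <- uv]]]; exists (h u), (h v); rewrite /= !hK hE.
- move=> a b /= /fC; rewrite gE => -[/(can_inj gK)|]; by [left | right].
Qed.

Section EdgelessGraph.
Variable T : finType.
Definition edgeless_rel : rel T := fun _ _ => false.
Lemma edgeless_sym : ssrbool.symmetric edgeless_rel. Proof. by []. Qed.
Lemma edgeless_irr : irreflexive edgeless_rel. Proof. by []. Qed.
Definition edgeless : sgraph := SGraph edgeless_sym edgeless_irr.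
End EdgelessGraph.

(** The cone is a star, and [obind insub] sends [a] to [None], that is, merges it with the apex. *)
Lemma star_contraction (G : sgraph) (a : G) :
  (forall b c : G, ~~ edge b c) ->
  edge_contraction (G := cone G) (G' := cone (edgeless {z : G | z != a}))
    (obind insub).
Proof.
move=> ne; split.
- by move=> [z|]; [exists (Some (val z)); rewrite /= valK | exists None].
- move=> [b|] [c|] //=; first by rewrite (negPf (ne b c)).
  + by case: insubP => [z _ _ _|_ _]; [right | left].
  + by case: insubP => [z _ _ _|_ _]; [right | left].
- move=> [b|] [c|] //= _.
  + by exists (Some (val b)), None; rewrite /= valK.
  + by exists None, (Some (val c)); rewrite /= valK.
- move=> [b|] [c|] /=; try by [left | right].
  case: insubP => [z _ <-|]; case: insubP => [z' _ <-|] //.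
    by case=> ->; left.
  by rewrite !negbK => /eqP-> /eqP-> _; left.
Qed.

(* The edge comes from one of the smaller graphs, except in a cone over an
   edgeless graph, where it joins the apex to any other vertex. *)
Lemma edge_contraction_max (G : sgraph) e m :
  class_exponents G e -> m \in e -> 0 < m -> all (leq^~ m) e ->
  exists e' (G' : sgraph) (f : G -> G'),
    [/\ perm_eq e (m :: e'), edge_contraction f & class_exponents G' e'].
Proof.
move=> cG; elim: cG m => {G e} [G ne|G H e1 e2 hG h1 hH h2
  |G H x y e1 e2 hG h1 hH h2|G e hG h|G H e GH _ h|G e1 e2 e12 _ h] m.
- by rewrite mem_nseq => /andP[_ /eqP->].
- rewrite mem_cat all_cat => /orP[me|me] m0 /andP[a1 a2].
    have [e' [G' [f [p fc cG']]]] := h1 m me m0 a1.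
    exists (e' ++ e2), (disjoint_union G' H); eexists; split.
    + by rewrite -cat_cons perm_cat.
    + exact: edge_contraction_union_l fc.
    + exact: class_exponents_union.
  have [e' [G' [f [p fc cG']]]] := h2 m me m0 a2.
  exists (e1 ++ e'), (disjoint_union G G'); eexists; split.
  + by rewrite -cat1s perm_sym perm_catCA perm_cat // perm_sym.
  + exact: edge_contraction_union_r fc.
  + exact: class_exponents_union.
(* As [m] is positive, removing it leaves the zero that the gluing rule requires. *)
- have zero_out e' : 0 < m -> forall d, perm_eq (0 :: d) (m :: e') ->
      exists2 e'', perm_eq e' (0 :: e'') & perm_eq d (m :: e'').
    move=> m0 d p; have z : 0 \in e'.
      by have := mem_head 0 d; rewrite (perm_mem p) inE; case: eqVneq m0 => // <-.
    exists (rem 0 e'); first exact: perm_to_rem.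
    rewrite -(perm_cons 0) (perm_trans p) // perm_sym.
    rewrite -[m :: rem 0 e']cat1s -cat1s perm_catCA /= perm_cons perm_sym.
    exact: perm_to_rem.
  move=> me m0 /=; rewrite all_cat => /andP[a1 a2].
  have {me} : (m \in 0 :: e1) \/ (m \in 0 :: e2).
    by move: me; rewrite !inE mem_cat; case/or3P=> ->; rewrite ?orbT; auto.
  case=> me.
    have [e' [G' [f [p fc cG']]]] := h1 m me m0 a1.
    have [e'' p1 p2] := zero_out _ m0 _ p.
    exists (0 :: e'' ++ e2), (glue (f x) y); eexists; split.
    + rewrite -[m :: _]cat1s -[0 :: e'' ++ e2]cat1s perm_sym perm_catCA perm_sym.
      by rewrite /= perm_cons -cat_cons perm_cat.
    + exact: edge_contraction_glue_l fc.
    + by apply: class_exponents_glue => //; apply: class_exponents_perm cG'.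
  have [e' [G' [f [p fc cG']]]] := h2 m me m0 a2.
  have [e'' p1 p2] := zero_out _ m0 _ p.
  exists (0 :: e1 ++ e''), (glue x (f y)); eexists; split.
  + rewrite -[m :: _]cat1s -[0 :: e1 ++ e'']cat1s perm_sym perm_catCA perm_sym.
    by rewrite /= perm_cons -[m :: _]cat1s perm_sym perm_catCA perm_cat // perm_sym.
  + exact: edge_contraction_glue_r fc.
  + by apply: class_exponents_glue => //; apply: class_exponents_perm cG'.
- rewrite inE; case: m => // m /=; rewrite (mem_map succn_inj) => me _.
  rewrite all_map => am.
  have swap (d : seq nat) k : perm_eq (0 :: k :: d) (k :: 0 :: d).
    by rewrite -cat1s -[k :: d]cat1s -[k :: 0 :: d]cat1s -[0 :: d]cat1s perm_catCA.
  (* The largest exponent of the cone is now [m.+1]. If [m] is 0, the base has no edge to contract,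
     and the star case applies. *)
  have [m0|m0] := posnP m.
    subst m.
    have e0 : all (eq_op^~ 0) e.
      by apply/allP => k /(allP am) /=; rewrite ltnS leqn0.
    have ne a b := class_exponents_zero_edgeless a b hG e0.
    have eE : e = nseq #|G| 0 by rewrite -(class_exponents_size hG); exact/all_pred1P.
    have G0 : 0 < #|G| by rewrite -(class_exponents_size hG); case: (e) me.
    have [a _] : exists a : G, a \in G by exact/card_gt0P.
    exists (0 :: map S (nseq #|edgeless {z : G | z != a}| 0)).
    exists (cone (edgeless {z : G | z != a})), (obind insub); split.
    + rewrite eE -(prednK G0) /= (perm_trans _ (swap _ _)) //.
      by rewrite card_sig -(cardC1 a).
    + exact: star_contraction.
    + by apply: class_exponents_cone; apply: class_exponents_edgeless.
  have [e' [G' [f [p fc cG']]]] := h m me m0 am.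
  exists (0 :: map S e'), (cone G'), (omap f); split.
  + by rewrite perm_sym (perm_trans (y := 0 :: m.+1 :: map S e')) //
      1?perm_sym ?swap // perm_cons -[m.+1 :: _]/(map S (m :: e')) perm_map.
  + exact: edge_contraction_cone.
  + exact: class_exponents_cone.
- move=> me m0 am; have [e' [G' [f [p fc cG']]]] := h m me m0 am.
  by have [f' fc'] := edge_contraction_iso GH fc; exists e', G', f'.
- rewrite -(perm_mem e12) -(perm_all _ e12) => me m0 am.
  have [e' [G' [f [p fc cG']]]] := h m me m0 am.
  by exists e', G', f; split=> //; rewrite perm_sym in e12; apply: perm_trans p.
Qed.

(** Contractions are recorded by their kernels [R d] on the fixed graph [G], so that levels with
    different targets can be compared. The induction removes the last, hence largest, exponent; the
    lowest level has only zero exponents left. *)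
Lemma contraction_tower (G : sgraph) e : class_exponents G e -> sorted leq e ->
  exists R : nat -> rel G,
    (forall d, count_mem 0 e <= d <= size e ->
      exists (G' : sgraph) (f : G -> G'), [/\ contraction f, class_exponents G' (take d e)
        & forall a b, R d a b = (f a == f b)]) /\
    (forall d, count_mem 0 e <= d < size e -> subrel (R d.+1) (R d)).
Proof.
elim/last_ind: e G => [|e m IH] G cG se.
  exists (fun _ => eq_op); split=> [d|d]; last by rewrite ltn0 andbF.
  by move=> _; exists G, id; split=> //; exact: contraction_id.
move: se; rewrite (sorted_pairwise leq_trans) pairwise_rcons => /andP[am].
rewrite -(sorted_pairwise leq_trans) => se.
have id_level : exists (G' : sgraph) (f : G -> G'), [/\ contraction f,
    class_exponents G' (take (size e).+1 (rcons e m))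
    & forall a b, (a == b) = (f a == f b)].
  exists G, id; split=> //; first exact: contraction_id.
  by rewrite -(size_rcons e m) take_size.
have [m0|m0] := posnP m.
  have c0 : count_mem 0 (rcons e m) = (size e).+1.
    rewrite -(size_rcons e m); apply/eqP; rewrite -all_count all_rcons m0 /=.
    by apply/allP => k /(allP am); rewrite m0 leqn0.
  exists (fun _ => eq_op); rewrite c0 size_rcons; split=> d.
    by rewrite -eqn_leq => /eqP<-.
  by case/andP=> h; rewrite ltnNge h.
have [||e' [G' [f [p fc cG']]]] := edge_contraction_max cG _ m0.
- by rewrite mem_rcons mem_head.
- by rewrite all_rcons leqnn.
have cf := edge_contraction_contraction fc.
have {}cG' : class_exponents G' e.
  apply: class_exponents_perm cG'; move: p.
  by rewrite perm_rcons perm_cons perm_sym.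
have [R' [lvl incl]] := IH _ cG' se.
(* The top level is [G] itself; lower levels are those of the contracted graph, pulled back along
   [f]. *)
exists (fun d a b => if d == (size e).+1 then a == b else R' d (f a) (f b)).
rewrite -cats1 count_cat /= eqn0Ngt m0 !addn0 size_cat addn1 cats1.
split=> d.
  case: eqVneq => [->//|dn] /andP[d0 dl].
  have {}dl : d <= size e by rewrite -ltnS ltn_neqAle dn.
  have [|G'' [g [cg cG'' E]]] := lvl d; first by rewrite d0.
  exists G'', (g \o f); split=> //; first exact: contraction_comp.
  by rewrite -cats1 takel_cat.
move=> /andP[d0 dl] a b; rewrite (ltn_eqF dl) eqSS.
case: eqVneq => [dE /eqP->|dn]; last first.
  by apply: incl; rewrite d0 ltn_neqAle dn -ltnS.
by have [|? [g [_ _ ->]]] := lvl d; rewrite ?d0 ?dE /=.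
Qed.

(** * Freeness *)

Local Open Scope ring_scope.

(** * Derivations of the polynomial ring and divisibility by differences of variables *)

Section Polynomials.
Variables (K : fieldType) (n : nat).
Local Notation S := {mpoly K[n]}.

Lemma mpoly_alg_ind (P : S -> Prop) :
  (forall c, P c%:MP) -> (forall i, P 'X_i) ->
  (forall p q, P p -> P q -> P (p + q)) ->
  (forall p q, P p -> P q -> P (p * q)) -> forall p, P p.
Proof.
move=> PC PX PD PM; elim/mpolyind => [|c m p _ _ IH]; first by rewrite -mpolyC0.
apply: PD => //; rewrite -mul_mpolyC; apply: (PM) => //.
rewrite mpolyXE_id; elim/big_ind: _ => [||i _]; [by rewrite -mpolyC1 | exact: PM |].
elim: (m i) => [|k IHk]; first by rewrite expr0 -mpolyC1.
by rewrite exprS; exact: PM.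
Qed.

Definition der (h : 'I_n -> S) (f : S) : S := \sum_j h j * f^`M(j).

Lemma derX h i : der h 'X_i = h i.
Proof.
rewrite /der (bigD1 i) //= big1 => [|j ji]; rewrite mderivX mnm1E.
  rewrite eqxx scale1r addr0 (_ : U_(i) - U_(i) = 0)%MM ?mpolyX0 ?mulr1 //.
  by apply/mnmP => j; rewrite mnmBE subnn mnm0E.
by rewrite [i == j]eq_sym (negPf ji) scale0r mulr0.
Qed.

Lemma der_derivation h : derivation (der h).
Proof.
split=> [c f g|f g]; rewrite /der.
  rewrite scaler_sumr -big_split; apply: eq_bigr => j _ /=.
  by rewrite mderivD mderivZ mulrDr scalerAr.
rewrite mulr_suml mulr_sumr -big_split; apply: eq_bigr => j _ /=.
by rewrite mderivM mulrDr; congr (_ + _); [exact: mulrA | exact: mulrCA].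
Qed.

Lemma derivationD (theta : S -> S) f g :
  derivation theta -> theta (f + g) = theta f + theta g.
Proof. by move=> [lin _]; rewrite -[f]scale1r lin !scale1r. Qed.

Lemma derivationZ (theta : S -> S) (c : K) f :
  derivation theta -> theta (c *: f) = c *: theta f.
Proof.
move=> dt; have t0 : theta 0 = 0.
  by apply: (addrI (theta 0)); rewrite -derivationD // !addr0.
by rewrite -[c *: f]addr0 dt.1 t0 addr0.
Qed.

Lemma derivationB (theta : S -> S) f g :
  derivation theta -> theta (f - g) = theta f - theta g.
Proof.
by move=> dt; rewrite derivationD // -scaleN1r derivationZ // scaleN1r.
Qed.

Lemma derivationC (theta : S -> S) (c : K) : derivation theta -> theta c%:MP = 0.
Proof.
move=> dt; have t1 : theta 1 = 0.
  apply: (addrI (theta 1)); rewrite addr0.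
  by rewrite -[in RHS](mulr1 1) dt.2 mulr1 mul1r.
by rewrite -[c%:MP]mulr1 mul_mpolyC derivationZ // t1 scaler0.
Qed.

Lemma derivation_der (theta : S -> S) f :
  derivation theta -> theta f = der (fun i => theta 'X_i) f.
Proof.
move=> dt; have dd := der_derivation (fun i => theta 'X_i).
elim/mpoly_alg_ind: f => [c|i|f g hf hg|f g hf hg].
- by rewrite !derivationC.
- by rewrite derX.
- by rewrite !derivationD // hf hg.
- by rewrite dt.2 dd.2 hf hg.
Qed.

(** Restriction to the hyperplane where the variables [k] and [i] agree; its vanishing tests
    divisibility by their difference. *)
Definition subst_var (k i : 'I_n) (f : S) : S :=
  f \mPo [tuple if j == k then 'X_i else 'X_j | j < n].

Lemma subst_varX k i j : subst_var k i 'X_j = if j == k then 'X_i else 'X_j.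
Proof. by rewrite /subst_var comp_mpolyXU -tnth_nth tnth_mktuple. Qed.

Lemma dvd_subst_var k i f :
  exists g, f - subst_var k i f = ('X_k - 'X_i) * g.
Proof.
elim/mpoly_alg_ind: f => [c|j|f g [f' hf] [g' hg]|f g [f' hf] [g' hg]].
- by exists 0; rewrite /subst_var comp_mpolyC subrr mulr0.
- rewrite subst_varX; case: eqVneq => [->|_]; first by exists 1; rewrite mulr1.
  by exists 0; rewrite subrr mulr0.
- exists (f' + g'); rewrite /subst_var rmorphD mulrDr -hf -hg /subst_var.
  by rewrite opprD addrACA.
(* With a tilde for the substitution, $fg - \tilde f\tilde g = (f-\tilde f)g + \tilde f(g-\tilde
   g)$. *)
- exists (f' * g + subst_var k i f * g').
  rewrite mulrDr mulrA -hf [X in _ = _ + X]mulrCA -hg /subst_var rmorphM.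
  by rewrite mulrBl mulrBr addrA subrK.
Qed.

Lemma subst_var_eq0 k i f :
  subst_var k i f = 0 <-> exists g, f = ('X_k - 'X_i) * g.
Proof.
split=> [f0|[g ->]]; first by have [g] := dvd_subst_var k i f; rewrite f0 subr0; exists g.
rewrite /subst_var rmorphM rmorphB /= -!/(subst_var _ _ _) !subst_varX eqxx.
by case: eqVneq => [->|_]; rewrite subrr mul0r.
Qed.

Lemma mpolyX_sub_neq0 (i j : 'I_n) : i != j -> 'X_i - 'X_j != 0 :> S.
Proof.
move=> ij; rewrite subr_eq0; apply: contraNneq ij => /(congr1 (mcoeff U_(i))).
by rewrite !mcoeffXU eqxx; case: eqVneq => // _ /eqP; rewrite oner_eq0.
Qed.

(** The factors are split off one at a time: setting $x_k = x_j$ turns $x_k - x_i$ into $x_j - x_i$,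
    which is nonzero for $j \neq i$, so the quotient inherits the remaining vanishing conditions. *)
Lemma dvd_prod_sub k (s : seq 'I_n) f : uniq s ->
  {in s, forall i, subst_var k i f = 0} -> k \notin s ->
  exists g, f = (\prod_(i <- s) ('X_k - 'X_i)) * g.
Proof.
elim: s f => [|i s IH] f /=; first by exists f; rewrite big_nil mul1r.
case/andP=> si us h; rewrite inE negb_or => /andP[ki ks].
have [g fE] := (subst_var_eq0 k i f).1 (h i (mem_head i s)).
have [|g' gE] := IH g us _ ks; last first.
  by exists g'; rewrite big_cons -mulrA -gE.
move=> j js; have : subst_var k j f = 0 by apply: h; rewrite inE js orbT.
rewrite fE /subst_var rmorphM rmorphB /= -!/(subst_var _ _ _) !subst_varX eqxx.
rewrite eq_sym (negPf ki) => /eqP; rewrite mulf_eq0 (negPf (mpolyX_sub_neq0 _)) /=.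
  by move/eqP.
by apply: contraNneq si => <-.
Qed.

Lemma linear_poly_sub (a b : 'I_n) :
  linear_poly (coord_form K a - coord_form K b) = 'X_a - 'X_b.
Proof.
rewrite /linear_poly (eq_bigr (fun i => (i == a)%:R *: 'X_i - (i == b)%:R *: 'X_i)).
  have delta c : \sum_(i < n) (i == c)%:R *: 'X_i = 'X_c :> S.
    by rewrite (bigD1 c) //= eqxx scale1r big1 ?addr0 // => i /negPf->; rewrite scale0r.
  by rewrite sumrB !delta.
move=> i _; rewrite add_lfunE opp_lfunE !lfunE /= /coord_fun !mxE eqxx /= scalerBl.
by rewrite ![i == _]eq_sym.
Qed.

(** The hyperplane contains $e_i$ for $i \neq a, b$ as well as $e_a + e_b$; evaluating [alpha] there
    fixes all its coefficients up to one scalar. *)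
Lemma linear_poly_ker (a b : 'I_n) (alpha : 'Hom('rV[K]_n, K^o)) :
  a != b -> lker alpha = diff_hyperplane K a b ->
  exists c : K, linear_poly alpha = c *: ('X_a - 'X_b).
Proof.
move=> ab kE; exists (alpha (delta_mx 0 a)).
have z i : i != a -> i != b -> alpha (delta_mx 0 i) = 0.
  move=> ia ib; apply/eqP; rewrite -memv_ker kE mem_diff_hyperplane !mxE /=.
  by rewrite ![_ == i]eq_sym (negPf ia) (negPf ib).
have abz : alpha (delta_mx 0 b) = - alpha (delta_mx 0 a).
  apply/eqP; rewrite -addr_eq0 -linearD -memv_ker kE mem_diff_hyperplane !mxE /= !eqxx.
  by rewrite [b == a]eq_sym (negPf ab) addr0 add0r.
rewrite /linear_poly (bigD1 a) //= (bigD1 b) 1?eq_sym //= big1 ?addr0 => [|i /andP[ia ib]].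
  by rewrite abz scaleNr scalerBr.
by rewrite z // scale0r.
Qed.

End Polynomials.

(** * A basis of the logarithmic derivations from an elimination ordering *)

Section FreeFromElimination.
Variables (K : fieldType) (n : nat).
Local Notation S := {mpoly K[n]}.
Variables (r : rel 'I_n) (p : 'I_n -> nat).
Hypotheses (r_sym : ssrbool.symmetric r) (r_irr : irreflexive r).
Hypothesis p_inj : injective p.
Hypothesis r_clique : forall k a b, (p a < p k)%N -> (p b < p k)%N ->
  r k a -> r k b -> a != b -> r a b.

(** This is $N_k$, with [p] giving the position of a vertex in the ordering; [descendant k] below is
    $D_k$. *)
Definition earlier (k : 'I_n) : seq 'I_n :=
  [seq i <- enum 'I_n | r k i && (p i < p k)%N].

Lemma mem_earlier k i : (i \in earlier k) = r k i && (p i < p k)%N.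
Proof. by rewrite mem_filter mem_enum andbT. Qed.

Definition ascending : rel 'I_n := fun a b => r a b && (p a < p b)%N.

Definition descendant k := connect ascending k.

Lemma descendant_le k a : descendant k a -> (p k <= p a)%N.
Proof.
case/connectP=> s + ->; elim: s k => //= b s IH k /andP[/andP[_ kb] /IH].
exact: leq_trans (ltnW kb).
Qed.

Lemma descendant_last k a : descendant k a -> a = k \/
  exists c, [/\ descendant k c, r c a & (p c < p a)%N].
Proof.
case/connectP=> s; elim/last_ind: s => [_ ->|s b _]; first by left.
rewrite rcons_path last_rcons => /andP[ps /andP[h1 h2]] ->; right.
by exists (last k s); split=> //; apply/connectP; exists s.
Qed.

(** The vertex [b] precedes [a], since otherwise the ascending path would extend to [b]. If [a] is
    not [k], its predecessor [c] on the path and [b] are both earlier neighbours of [a], hence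
    adjacent, and the argument repeats with [c]. *)
Lemma descendant_boundary k a b : descendant k a -> r a b ->
  ~~ descendant k b -> b \in earlier k.
Proof.
have [m] := ubnP (p a); elim: m a => // m IH a; rewrite ltnS => pam ka ab nb.
have up c : descendant k c -> r c b -> (p b < p c)%N.
  move=> kc cb; case: ltngtP (erefl (p b)) => // [cb'|/p_inj E] _.
    case/negP: nb; apply: connect_trans kc _; apply: connect1.
    by rewrite /ascending cb.
  by rewrite E r_irr in cb.
have ba := up a ka ab.
case: (descendant_last ka) => [E|[c [kc ca pca]]].
  by rewrite mem_earlier -E ab.
have cb : r c b.
  apply: (@r_clique a) => //; first by rewrite r_sym.
  by apply: contraNneq nb => <-.
exact: (IH c (leq_trans pca pam) kc cb nb).
Qed.

Definition basis_poly (k j : 'I_n) : S :=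
  \prod_(i <- earlier k) ('X_j - 'X_i).

(** The component of $\theta_k$ at $\partial/\partial x_j$. *)
Definition basis_coef (k j : 'I_n) : S :=
  if descendant k j then basis_poly k j else 0.

Definition log_vector (h : 'I_n -> S) :=
  forall a b, r a b -> exists g, h a - h b = ('X_a - 'X_b) * g.

Lemma basis_poly_dvd k j b :
  b \in earlier k -> exists g, basis_poly k j = ('X_j - 'X_b) * g.
Proof.
by move=> bk; rewrite /basis_poly (big_rem b) //=; eexists.
Qed.

(** For an edge inside $D_k$ the two products agree once $x_a = x_b$. An edge leaving $D_k$ ends in
    $N_k$, so its difference is one of the factors. Outside $D_k$ both components are 0. *)
Lemma basis_log k : log_vector (basis_coef k).
Proof.
have half a b : descendant k a -> ~~ descendant k b -> r a b ->
    exists g, basis_poly k a = ('X_a - 'X_b) * g.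
  by move=> ka nb ab; apply: basis_poly_dvd; apply: descendant_boundary ab nb.
move=> a b ab; rewrite /basis_coef.
case: ifPn => ka; case: ifPn => kb.
- apply/subst_var_eq0; rewrite /subst_var rmorphB -!/(subst_var _ _ _) /=.
  apply/eqP; rewrite subr_eq0 /basis_poly /subst_var !rmorph_prod /=.
  apply/eqP; apply: eq_bigr => i _.
  rewrite !rmorphB /= -!/(subst_var _ _ _) !subst_varX eqxx.
  by rewrite if_same.
- by rewrite subr0; exact: half.
- rewrite sub0r; have [|g ->] := half b a kb ka; first by rewrite r_sym.
  by exists g; rewrite -mulNr opprB.
- by exists 0; rewrite subrr mulr0.
Qed.

Lemma basis_homog k j : basis_coef k j \is (size (earlier k)).-homog.
Proof.
rewrite /basis_coef; case: ifP => _; last exact: dhomog0.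
rewrite /basis_poly; elim: (earlier k) => [|i s IH].
  by rewrite big_nil; exact: dhomog1.
rewrite big_cons -[size _]/(1 + size s)%N; apply: dhomogM => //.
by apply: rpredB; rewrite dhomogX /= mdeg1.
Qed.

Lemma basis_coef_lt k j : (p j < p k)%N -> basis_coef k j = 0.
Proof.
by rewrite /basis_coef; case: ifP => // /descendant_le; rewrite ltnNge => ->.
Qed.

Lemma basis_coef_diag k : basis_coef k k = basis_poly k k.
Proof. by rewrite /basis_coef /descendant connect0. Qed.

Lemma basis_coef_neq0 k : basis_coef k k != 0.
Proof.
rewrite basis_coef_diag /basis_poly prodf_seq_neq0; apply/allP => i.
rewrite mem_earlier /= => /andP[ki _]; apply: mpolyX_sub_neq0.
by apply: contraTneq ki => ->; rewrite r_irr.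
Qed.

(** For each $i$ in $N_k$ the component $h_i$ is 0, so the edge condition makes $h_k$ divisible by
    $x_k - x_i$. *)
Lemma log_vector_diag h k : log_vector h ->
  (forall j, (p j < p k)%N -> h j = 0) -> exists g, h k = g * basis_coef k k.
Proof.
move=> lh h0; rewrite basis_coef_diag.
have [|||g ->] := @dvd_prod_sub K n k (earlier k) (h k); last by exists g; rewrite mulrC.
- by rewrite filter_uniq ?enum_uniq.
- move=> i; rewrite mem_earlier => /andP[ki pik]; apply/subst_var_eq0.
  by have [g] := lh _ _ ki; rewrite (h0 i) // subr0; exists g.
- by rewrite mem_earlier r_irr.
Qed.

(** Triangular elimination in the order of positions: the remainder stays logarithmic, and its first
    possibly nonzero component is cancelled by a multiple of the corresponding basis vector, which
    vanishes at all earlier positions. *)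
Lemma basis_generates h : log_vector h ->
  exists c : 'I_n -> S, forall j, h j = \sum_k c k * basis_coef k j.
Proof.
move=> lh.
suff claim m : exists c : 'I_n -> S, forall j, (p j < m)%N ->
    h j = \sum_k c k * basis_coef k j.
  have [c hc] := claim (\max_j p j).+1; exists c => j; apply: hc.
  by rewrite ltnS leq_bigmax.
elim: m => [|m [c hc]]; first by exists (fun=> 0).
pose h' j := h j - \sum_k c k * basis_coef k j.
have h'0 j : (p j < m)%N -> h' j = 0 by move=> /hc E; rewrite /h' E subrr.
have lh' : log_vector h'.
  move=> a b ab; have [g gE] := lh _ _ ab.
  have /fin_all_exists[f fE] : forall k, exists f,
      basis_coef k a - basis_coef k b = ('X_a - 'X_b) * f.
    by move=> k; exact: basis_log.
  exists (g - \sum_k c k * f k).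
  rewrite /h' mulrBr -gE opprD addrACA -opprD; congr (_ - _).
  rewrite -sumrB mulr_sumr; apply: eq_bigr => k _.
  by rewrite -mulrBr fE mulrCA.
(* Positions are injective but may have gaps; at a gap the old coefficients still serve. *)
have [k pk|nk] := pickP (fun k => p k == m); last first.
  exists c => j; rewrite ltnS leq_eqVlt nk /=; exact: hc.
move/eqP: pk => pk; rewrite -pk in h'0 hc *.
have [g gE] := log_vector_diag lh' h'0.
exists (fun i => c i + (i == k)%:R * g) => j.
under eq_bigr do rewrite mulrDl; rewrite big_split /= [X in _ + X](bigD1 k) //= eqxx mul1r.
rewrite ltnS leq_eqVlt => /orP[/eqP/p_inj->|pj].
  rewrite -gE [X in _ + (_ + X)]big1 => [|i /negPf->]; last by rewrite !mul0r.
  by rewrite addr0 /h' addrC subrK.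
rewrite hc // (basis_coef_lt pj) mulr0 add0r [X in _ + X]big1 ?addr0 // => i /negPf->.
by rewrite !mul0r.
Qed.

(** In component [k], terms of later vectors vanish by triangularity and those of earlier ones by
    induction, leaving [c k] times a nonzero diagonal entry. *)
Lemma basis_independent (c : 'I_n -> S) :
  (forall j, \sum_k c k * basis_coef k j = 0) -> forall k, c k = 0.
Proof.
move=> h k; have [m] := ubnP (p k); elim: m k => // m IH k; rewrite ltnS => pk.
have /eqP := h k; rewrite (bigD1 k) //= big1 ?addr0 => [|i ik].
  by rewrite mulf_eq0 (negPf (basis_coef_neq0 k)) orbF => /eqP.
case: (ltngtP (p i) (p k)) => [ik'|ki|/p_inj E].
- by rewrite IH ?mul0r // (leq_trans ik').
- by rewrite basis_coef_lt // mulr0.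
- by rewrite E eqxx in ik.
Qed.

Lemma free_of_elimination (A : arrangement K n) (e : seq nat) :
  (forall H, H \in A <-> exists a b, r a b /\ H = diff_hyperplane K a b) ->
  perm_eq e [seq size (earlier k) | k <- enum 'I_n] ->
  free_with_exponents A e.
Proof.
move=> AE pe.
have es : size e = n by rewrite (perm_size pe) size_map size_enum_ord.
(* The permutation between the two exponent lists assigns to each position in [e] a vertex with that
   exponent. *)
have [s [sb sE]] : exists s : 'I_(size e) -> 'I_n, bijective s /\
    forall k : 'I_(size e), nth 0%N e k = size (earlier (s k)).
  have /tuple_permP[t tE] : perm_eq e [tuple size (earlier k) | k < n].
    by rewrite (perm_trans pe) // /= enumT.
  exists (fun k => t (cast_ord es k)); split.
    exists (fun k => cast_ord (esym es) ((t^-1)%g k)) => k.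
      by rewrite permK cast_ordK.
    by rewrite cast_ordKV permKV.
  move=> k; rewrite {1}tE -[val k]/(val (cast_ord es k)).
  by rewrite -tnth_nth !tnth_mktuple.
have log_der theta : log_derivation A theta <->
    derivation theta /\ log_vector (fun i => theta 'X_i).
  split=> -[dt lt]; split=> //.
    move=> a b ab; have [|g] := lt (coord_form K a - coord_form K b).
      by apply/AE; exists a, b.
    by rewrite linear_poly_sub derivationB //; exists g.
  move=> alpha /AE[a [b [ab kE]]].
  have [|c ->] := linear_poly_ker _ kE.
    by apply: contraTneq ab => ->; rewrite r_irr.
  have [g gE] := lt _ _ ab; exists g.
  by rewrite derivationZ // derivationB // gE scalerAl.
have [s' sK s'K] := sb.
exists (fun k => der (basis_coef (s k))); split.
- move=> k; apply/log_der; split; first exact: der_derivation.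
  by move=> a b ab; rewrite !derX; exact: basis_log.
- by move=> k i; rewrite derX sE; exact: basis_homog.
- move=> eta /log_der[deta leta]; have [c hc] := basis_generates leta.
  exists (c \o s) => f; rewrite (derivation_der _ deta) /der.
  under eq_bigr do rewrite hc mulr_suml.
  rewrite exchange_big (reindex s) /=; last by apply: onW_bij.
  by apply: eq_bigr => k _; rewrite mulr_sumr; apply: eq_bigr => j _; rewrite mulrA.
- move=> c h k; rewrite -(sK k).
  apply: (@basis_independent (c \o s')) => j /=.
  rewrite (reindex s) /=; last by apply: onW_bij.
  by rewrite -[RHS](h 'X_j); apply: eq_bigr => i _; rewrite sK derX.
Qed.

End FreeFromElimination.

(** * Restrictions and flags *)

Lemma memv_bigcap_seq (K : fieldType) (vT : vectType K) (s : seq {vspace vT}) x :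
  (x \in (\bigcap_(H <- s) H)%VS) = all (fun H : {vspace vT} => x \in H) s.
Proof.
elim: s => [|H s IH]; first by rewrite big_nil memvf.
by rewrite big_cons memv_cap IH.
Qed.

Lemma graphic_arrangementP (K : fieldType) n (G : sgraph) (v : 'I_n -> G) H :
  H \in graphic_arrangement K v <->
  exists a b, edge (v a) (v b) /\ H = diff_hyperplane K a b.
Proof.
split=> [/imfsetP[[a b] /= ab ->]|[a [b [ab ->]]]]; first by exists a, b.
by apply/imfsetP; exists (a, b).
Qed.

Section FreeGraphic.
Variables (K : fieldType) (n : nat) (G : sgraph) (v : 'I_n -> G).
Hypothesis v_bij : bijective v.

(** The arrangement is given by its members only, so that the result also covers a restriction
    carried over to coordinates of its flat. *)
Lemma free_graphic (A : arrangement K n) e : class_exponents G e ->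
  (forall H, H \in A <->
    exists a b, edge (v a) (v b) /\ H = diff_hyperplane K a b) ->
  free_with_exponents A e.
Proof.
move=> /class_exponents_elimination[[s [us sG ps pe]] _] AE.
have v_inj := bij_inj v_bij.
(* The head of [s] is added last, so positions count from the end of the list. *)
pose p i := (size s - index (v i) s)%N.
have pE i k : (p i < p k)%N = (index (v k) s < index (v i) s)%N.
  by rewrite /p ltn_sub2lE // ltnW // index_mem sG.
apply: (free_of_elimination (r := fun a b => edge (v a) (v b)) (p := p)) => //.
- by move=> a b; rewrite edge_sym.
- by move=> a; rewrite edge_irr.
- move=> a b pab; apply: v_inj; have ia : index (v a) s = index (v b) s.
    have := pE a b; have := pE b a; rewrite pab ltnn.
    by case: ltngtP.
  by rewrite -[v a](nth_index (v a) (s := s)) ?sG // ia nth_index ?sG.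
- move=> k a b; rewrite !pE => ka kb ea eb ab.
  by apply: (perfect_index ps ka kb); rewrite ?sG ?(inj_eq v_inj).
- have sv : perm_eq s (map v (enum 'I_n)).
    apply: uniq_perm => //; first by rewrite map_inj_uniq // enum_uniq.
    have [w vK wK] := v_bij.
    by move=> z; rewrite sG -[z]wK mem_map // mem_enum.
  rewrite (perm_trans pe) // back_degrees_index //.
  rewrite (perm_trans (perm_map _ sv)) // -map_comp.
  rewrite (eq_map (g := fun k => size (earlier (fun a b => edge (v a) (v b)) p k))) //.
  move=> k /=; rewrite size_filter (seq.permP sv) count_map; apply: eq_count => i /=.
  by rewrite pE.
Qed.

End FreeGraphic.

(** * Flats as coordinate spaces of contracted graphs *)

Section Pullback.
Variables (K : fieldType) (n d : nat) (q : 'I_n -> 'I_d).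

Definition pullback_fun (x : 'rV[K]_d) : 'rV[K]_n := \row_i x 0 (q i).

Lemma pullback_fun_linear : linear pullback_fun.
Proof. by move=> c x y; apply/rowP => i; rewrite !mxE. Qed.

HB.instance Definition _ :=
  GRing.isLinear.Build K 'rV[K]_d 'rV[K]_n _ pullback_fun pullback_fun_linear.

Definition pullback : 'Hom('rV[K]_d, 'rV[K]_n) := linfun pullback_fun.

Lemma pullbackE x i : pullback x 0 i = x 0 (q i).
Proof. by rewrite lfunE /= mxE. Qed.

Lemma preim_diff_hyperplane i j :
  (pullback @^-1: diff_hyperplane K i j)%VS = diff_hyperplane K (q i) (q j).
Proof.
apply/vspaceP => x.
by rewrite -memv_preim !mem_diff_hyperplane !pullbackE.
Qed.

End Pullback.

Section Level.
Variables (K : fieldType) (n : nat) (G G' : sgraph).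
Variables (v : 'I_n -> G) (f : G -> G') (X : {vspace 'rV[K]_n}).
Hypothesis v_bij : bijective v.
Hypothesis f_contr : contraction f.
Hypothesis memX : forall x,
  x \in X <-> forall i j, f (v i) = f (v j) -> x 0 i = x 0 j.

Let q i := enum_rank (f (v i)).

Lemma contraction_index_surj k : exists i, q i = k.
Proof.
have [w vK wK] := v_bij; have [fS _ _ _] := f_contr.
by have [a E] := fS (enum_val k); exists (w a); rewrite /q wK E enum_valK.
Qed.

Lemma ker_level : lker (pullback K q) = 0%VS.
Proof.
apply/eqP; rewrite -subv0; apply/subvP => x; rewrite memv_ker memv0 => /eqP x0.
apply/eqP/rowP => k; have [i <-] := contraction_index_surj k.
by rewrite -pullbackE x0 !mxE.
Qed.

Lemma img_level : limg (pullback K q) = X.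
Proof.
have /fin_all_exists[g gK] := contraction_index_surj.
apply/vspaceP => x; apply/idP/idP.
  by case/memv_imgP=> y _ ->; apply/memX => i j fij; rewrite !pullbackE /q fij.
(* A vector constant on the fibers is recovered from its values at one representative [g k] of each
   fiber. *)
move=> /memX xX; apply/memv_imgP; exists (\row_k x 0 (g k)); rewrite ?memvf //.
apply/rowP => i; rewrite pullbackE mxE; apply: xX.
by apply: enum_rank_inj; rewrite -/(q _) -/(q (g _)) gK.
Qed.

Lemma dim_level : \dim X = #|G'|.
Proof.
have := limg_ker_dim (pullback K q) fullv.
rewrite capfv ker_level dimv0 add0n img_level dimvf dim_matrix => ->.
exact: mul1n.
Qed.

(** In the coordinates of [X] the restriction is the graphic arrangement of [G']: edges inside a
    fiber give hyperplanes containing [X], which are discarded, and every edge of [G'] lifts to an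
    edge of [G]. *)
Lemma restriction_level (H : {vspace 'rV[K]_#|G'|}) :
  H \in [fset (pullback K q @^-1: H0)%VS
          | H0 in restriction (graphic_arrangement K v) X]%fset <->
  exists a b, edge (enum_val a) (enum_val b) /\ H = diff_hyperplane K a b.
Proof.
have preX i j : (pullback K q @^-1: (diff_hyperplane K i j :&: X))%VS =
    diff_hyperplane K (q i) (q j).
  rewrite -preim_diff_hyperplane; apply/vspaceP => x.
  by rewrite -!memv_preim memv_cap -img_level memv_img ?memvf ?andbT.
have [_ fE fL _] := f_contr; have [w vK wK] := v_bij.
split=> [/imfsetP[_ /imfsetP[H0 + ->] ->]|[a [b [ab ->]]]].
  rewrite inE => /andP[/graphic_arrangementP[i [j [ij ->]]] nX].
  rewrite preX; exists (q i), (q j); split=> //; rewrite !enum_rankK.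
  case: (fE _ _ ij) => // fij; case/negP: nX; apply/subvP => x /memX h.
  by rewrite mem_diff_hyperplane (h _ _ fij).
have [i' [j' [iE jE ij]]] := fL _ _ ab.
have qi : q (w i') = a by rewrite /q wK iE enum_valK.
have qj : q (w j') = b by rewrite /q wK jE enum_valK.
apply/imfsetP; exists (diff_hyperplane K (w i') (w j') :&: X)%VS; last first.
  by rewrite preX qi qj.
apply/imfsetP; exists (diff_hyperplane K (w i') (w j')) => //.
rewrite inE; apply/andP; split.
  by apply/graphic_arrangementP; exists (w i'), (w j'); rewrite !wK.
(* The indicator of the fiber over [a] lies in [X] but takes different values at the two ends of the
   lifted edge. *)
apply/negP => /subvP/(_ (pullback K q (delta_mx 0 a))).
rewrite -img_level memv_img ?memvf // => /(_ isT).
rewrite mem_diff_hyperplane !pullbackE qi qj !mxE !eqxx /=.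
by case: (eqVneq b a) ab => [->|_ _]; rewrite ?edge_irr ?oner_eq0.
Qed.

Lemma free_level e : class_exponents G' e ->
  free_in_with_exponents #|G'| X (restriction (graphic_arrangement K v) X) e.
Proof.
move=> ce; exists (pullback K q); split; [exact: ker_level | exact: img_level |].
apply: (free_graphic (v := enum_val)) ce restriction_level.
by exists enum_rank; [exact: enum_valK | exact: enum_rankK].
Qed.

(** The hyperplanes of the edges inside fibers suffice to cut out [X], because the fibers are
    connected. *)
Lemma level_in_lattice : in_lattice (graphic_arrangement K v) X.
Proof.
have [w vK wK] := v_bij; have [_ _ _ fC] := f_contr.
exists [fset diff_hyperplane K p.1 p.2 | p : 'I_n * 'I_n
   & edge (v p.1) (v p.2) && (f (v p.1) == f (v p.2))]%fset.
  apply/fsubsetP => _ /imfsetP[[i j] /= /andP[ij _] ->].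
  by apply/graphic_arrangementP; exists i, j.
apply/vspaceP => x; rewrite memv_bigcap_seq; apply/idP/allP => [xX H|xH].
  case/imfsetP=> -[i j] /= /andP[_ /eqP fij] ->.
  by rewrite mem_diff_hyperplane; apply/eqP; exact: (memX x).1.
apply/memX => i j fij; rewrite -(vK i) -(vK j).
apply: (fC K (fun a => x 0 (w a))) fij => a b ab fab.
apply/eqP; rewrite -mem_diff_hyperplane; apply: xH.
by apply/imfsetP; exists (w a, w b); rewrite //= inE /= !wK ab fab eqxx.
Qed.

End Level.

Lemma take_count_mem0 e : sorted leq e ->
  all (eq_op^~ 0%N) (take (count_mem 0%N e) e).
Proof.
elim: e => //= k e IH; rewrite (path_sortedE leq_trans) => /andP[ak /IH].
case: k ak => [|k] ak //=.
suff -> : count_mem 0%N e = 0%N by rewrite take0.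
by apply/eqP; rewrite -leqn0 leqNgt -has_count; apply/hasPn => z /(allP ak); case: z.
Qed.

Lemma class_exponents_flag_accurate (K : fieldType) (G : sgraph) n (v : 'I_n -> G) e :
  bijective v -> class_exponents G e -> flag_accurate (graphic_arrangement K v).
Proof.
move=> v_bij ce0.
have {ce0} ce : class_exponents G (sort leq e).
  by apply: class_exponents_perm ce0; rewrite perm_sym perm_sort.
move: (sort leq e) ce (sort_sorted leq_total e) => {}e ce se.
have en : size e = n by rewrite (class_exponents_size ce) -(bij_eq_card v_bij) card_ord.
have [R [lvl incl]] := contraction_tower ce se.
(* All related pairs enter here, adjacent or not, so that [X d] is by construction the space of
   vectors constant on the classes of [R d]. *)
pose X d : {vspace 'rV[K]_n} :=
  (\bigcap_(H <- [seq diff_hyperplane K p.1 p.2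
     | p <- enum (predT : pred ('I_n * 'I_n)) & R d (v p.1) (v p.2)]) H)%VS.
have memX d x : x \in X d <-> forall i j, R d (v i) (v j) -> x 0 i = x 0 j.
  rewrite memv_bigcap_seq all_map; split=> [/allP h i j ij|h].
    have := h (i, j); rewrite mem_filter ij mem_enum => /(_ isT) /=.
    by rewrite mem_diff_hyperplane => /eqP.
  apply/allP => -[i j]; rewrite mem_filter => /andP[/= ij _].
  by rewrite mem_diff_hyperplane (h _ _ ij).
have memXf d (G' : sgraph) (f : G -> G') : (forall a b, R d a b = (f a == f b)) ->
    forall x, x \in X d <-> forall i j, f (v i) = f (v j) -> x 0 i = x 0 j.
  move=> Rf x; rewrite memX; split=> h i j ij; apply: h; first by rewrite Rf ij.
  by apply/eqP; rewrite -Rf.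
(* At the lowest level only zero exponents remain, so every edge of [G] has been contracted and the
   flat lies in the center. Hence every dimension required of the flag is a level of the tower. *)
have zc : (count_mem 0%N e <= \dim (center (graphic_arrangement K v)))%N.
  have [|G' [f [cf cG' Rf]]] := lvl (count_mem 0%N e); first by rewrite leqnn count_size.
  have := dim_level v_bij cf (memXf _ _ _ Rf).
  rewrite -(class_exponents_size cG') size_takel ?count_size // => <-.
  apply: dimvS; apply/subvP => x /(memXf _ _ _ Rf) xX.
  rewrite memv_bigcap_seq; apply/allP => H /graphic_arrangementP[i [j [ij ->]]].
  rewrite mem_diff_hyperplane; apply/eqP; apply: xX.
  have [_ fE _ _] := cf; case: (fE _ _ ij) => // fij.
  have z := take_count_mem0 se.
  by case/negP: (class_exponents_zero_edgeless (f (v i)) (f (v j)) cG' z).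
exists e; split=> //.
  by apply: (free_graphic v_bij ce) => H; exact: graphic_arrangementP.
exists X; split=> d _ /andP[cd dn].
  have [|G' [f [cf cG' Rf]]] := lvl d; first by rewrite (leq_trans zc cd) en.
  have dG : #|G'| = d by rewrite -(class_exponents_size cG') size_takel ?en.
  have mX := memXf _ _ _ Rf.
  split; [exact: (level_in_lattice v_bij cf mX) | by rewrite (dim_level v_bij cf mX) |].
  by rewrite -{1}dG; exact: (free_level v_bij cf mX).
(* A finer relation imposes fewer equations, so the flats increase with [d]. *)
apply/subvP => x /memX xX; apply/memX => i j ij; apply: xX.
by apply: incl ij; rewrite (leq_trans zc cd) en.
Qed.

Theorem theorem6p18 (K : fieldType) (G : sgraph) (n : nat) (v : 'I_n -> G)
    (v_bij : bijective v) :
  (in_classG G -> flag_accurate (graphic_arrangement K v)) /\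
  (trivially_perfect G -> flag_accurate (graphic_arrangement K v)).
Proof.
suff main : in_classG G -> flag_accurate (graphic_arrangement K v).
  by split=> // /trivially_perfect_in_classG.
by case/in_classG_exponents => e; exact: class_exponents_flag_accurate.
Qed.
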